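(* For every nonnegative integer $n$, $C_1(n)=C_2(n)$, where: (i) $C_1(n)$ is the number of partitions of $n$ into parts congruent to $0$, $1$, $3$, or $5 \pmod 6$; (ii) $C_2(n)$ is the number of partitions of $n$ satisfying all of the following: (a) if two adjacent parts differ by exactly $1$, the smaller of the two is not $\equiv 1 \pmod 3$; (b) if two adjacent parts differ by exactly $2$, the smaller of the two is $\equiv 2 \pmod 3$; (c) no part equals $2$.
   Context: A partition of $n$ is a nonincreasing sequence of positive integers $\lambda_1\ge\lambda_2\ge\cdots\ge\lambda_k\ge1$ with sum $n$. ''Adjacent parts'' means $\lambda_j$ and $\lambda_{j+1}$ for some $j$, when the parts are written in nonincreasing order. *)

(* Defs.v *)
From mathcomp Require Import all_boot.
Set Implicit Arguments. Unset Strict Implicit. Unset Printing Implicit Defensive.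

Definition is_partition (n : nat) (s : seq nat) : bool :=
  [&& sorted geq s, all (fun x => 0 < x) s & sumn s == n].

Fixpoint all_seqs (m k : nat) : seq (seq nat) :=
  if k is k'.+1 then [seq x :: s | x <- iota 0 m.+1, s <- all_seqs m k'] else [:: [::]].

(* All sequences of length <= n with entries in {0,...,n}, without duplicates;
   every partition of n occurs in this list exactly once. *)
Definition candidates (n : nat) : seq (seq nat) :=
  flatten [seq all_seqs n k | k <- iota 0 n.+1].

Definition num_partitions (P : seq nat -> bool) (n : nat) : nat :=
  count (fun s => is_partition n s && P s) (candidates n).

Definition parts_mod6 (s : seq nat) : bool :=
  all (fun x => (x %% 6) \in [:: 0; 1; 3; 5]) s.

(* Condition on an adjacent pair (a, b) with a >= b (b is the smaller part). *)
Definition adj_ok (a b : nat) : bool :=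
  [&& (a - b == 1) ==> (b %% 3 != 1) & (a - b == 2) ==> (b %% 3 == 2)].

Definition cond2 (s : seq nat) : bool :=
  all (fun p => adj_ok p.1 p.2) (zip s (behead s)) && (2 \notin s).

Definition C1 (n : nat) : nat := num_partitions parts_mod6 n.
Definition C2 (n : nat) : nat := num_partitions cond2 n.

(* Main.v *)
Require Import Defs.
From mathcomp Require Import all_boot all_algebra.
From mathcomp Require Import zify ring.
Set Implicit Arguments. Unset Strict Implicit. Unset Printing Implicit Defensive.
Import GRing.Theory.

(* Partitions are built by adding a largest part, which gives linear recurrences
   for the generating functions S_m of the admissible partitions with parts at
   most m.  Under the pair conditions, let Q = q^3, a = q, b = q^2, and let tau_n,
   xi_n be S_(3n+2), S_(3n+3) multiplied by the product of the 1 - q^j over the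
   j <> 2 involved.  They satisfy a first-order linear system with coefficients
   polynomial in a, b, Q, and for indeterminate a, b, Q an induction gives
     tau_(n+1)(a,b) = (1 - aQ) xi_n(bQ,aQ).
   In the limit tau and xi agree, so F(a,b) = (1 - aQ) F(bQ,aQ), whence
     F(a,b) = prod_(i >= 0) (1 - aQ^(2i+1)) (1 - bQ^(2i+2)),
   that is, the product of the 1 - q^j over j = 2, 4 mod 6, j <> 2; dividing by
   the product over all j <> 2 leaves parts 0, 1, 3, 5 mod 6.  Power series
   are truncated by computing in a commutative ring where q^N = 0. *)

Local Open Scope ring_scope.

(** * Functional equation for the pair [tau], [xi] *)

Section TauXi.
Variable R : comNzRingType.
Implicit Types a b Q : R.

(* [tau n] and [xi n] are the generating functions of the pair-condition
   partitions into parts at most 3n+2, respectively 3n+3, cleared of denominators,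
   with a part 3k+1 marked by [a Q^k], 3k+2 by [b Q^k] and 3k by [Q^k]. *)
Fixpoint tau_xi a b Q n : R * R :=
  if n is k.+1 then
    let E := Q ^+ k.+1 in
    let t := (1 - b * E) * (tau_xi a b Q k).2
             + b * E * (1 - E) * (1 - a * E) * (tau_xi a b Q k).1 in
    (t, t - a * E * E * Q * (1 - b * E) * (tau_xi a b Q k).2)
  else (1, 1 - a * Q).

Definition tau a b Q n := (tau_xi a b Q n).1.
Definition xi a b Q n := (tau_xi a b Q n).2.

Lemma tau0 a b Q : tau a b Q 0 = 1. Proof. by []. Qed.
Lemma xi0 a b Q : xi a b Q 0 = 1 - a * Q. Proof. by []. Qed.

Lemma tauS a b Q n : tau a b Q n.+1 =
  (1 - b * Q ^+ n.+1) * xi a b Q n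
  + b * Q ^+ n.+1 * (1 - Q ^+ n.+1) * (1 - a * Q ^+ n.+1) * tau a b Q n.
Proof. by []. Qed.

Lemma xiS a b Q n : xi a b Q n.+1 = tau a b Q n.+1
  - a * Q ^+ n.+1 * Q ^+ n.+2 * (1 - b * Q ^+ n.+1) * xi a b Q n.
Proof. by rewrite [Q ^+ n.+2]exprSr /xi /tau /=; ring. Qed.

(** The second identity is the one wanted. Its induction step also meets [tau (b * Q) (a * Q) Q], so
    the first identity is carried along to close the induction. *)
Lemma tau_xi_swap a b Q n :
  (1 - a * Q) * tau (b * Q) (a * Q) Q n =
    (1 - b * Q ^+ n.+1) * xi a b Q n + b * Q ^+ n.+1 * (1 - a * Q ^+ n.+1) * tau a b Q n
  /\ tau a b Q n.+1 = (1 - a * Q) * xi (b * Q) (a * Q) Q n.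
Proof.
elim: n => [|n [IH1 IH2]].
  rewrite tauS !tau0 !xi0 expr1; split; ring.
have tS := tauS a b Q n.
have C : (1 - a * Q) * tau (b * Q) (a * Q) Q n.+1 =
    (1 - b * Q ^+ n.+2) * xi a b Q n.+1
    + b * Q ^+ n.+2 * (1 - a * Q ^+ n.+2) * tau a b Q n.+1.
  (* Multiplied by [1 - a * Q], the two terms of the swapped recurrence become multiples of the
     right side of [IH2] and of the left side of [IH1]. *)
  rewrite tauS mulrDr; set U := (1 - a * Q * _) * _.
  have -> : (1 - a * Q) * U =
      (1 - a * Q * Q ^+ n.+1) * ((1 - a * Q) * xi (b * Q) (a * Q) Q n).
    by rewrite /U; ring.
  set V := (X in _ + X = _).
  have -> : V = a * Q * Q ^+ n.+1 * (1 - Q ^+ n.+1) * (1 - b * Q * Q ^+ n.+1)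
      * ((1 - a * Q) * tau (b * Q) (a * Q) Q n).
    by rewrite /V; ring.
  rewrite -IH2 IH1 xiS tS [Q ^+ n.+2]exprS.
  ring.
split=> //.
rewrite tauS [xi (b * Q) _ _ _]xiS [RHS]mulrBr C.
have -> : (1 - a * Q) * (b * Q * Q ^+ n.+1 * Q ^+ n.+2 * (1 - a * Q * Q ^+ n.+1)
      * xi (b * Q) (a * Q) Q n) =
   b * Q * Q ^+ n.+1 * Q ^+ n.+2 * (1 - a * Q * Q ^+ n.+1) * tau a b Q n.+1.
  by rewrite IH2; ring.
rewrite [Q ^+ n.+2]exprS; ring.
Qed.

(** Past the nilpotency order the recurrence reads [tau a b Q n.+1 = xi a b Q n], so the swap
    becomes the functional equation of the limit. *)
Lemma xi_swap a b Q n : Q ^+ n = 0 ->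
  xi a b Q n = (1 - a * Q) * xi (b * Q) (a * Q) Q n.
Proof.
move=> Qn; have QSn : Q ^+ n.+1 = 0 by rewrite exprS Qn mulr0.
have [_ <-] := tau_xi_swap a b Q n.
rewrite tauS QSn; ring.
Qed.

(** Two swaps bring [a] and [b] back to their places, each scaled by [Q ^+ 2], and release one pair
    of factors. *)
Lemma xi_product a b Q n r : Q ^+ n = 0 ->
  xi a b Q n = (\prod_(i < r) ((1 - a * Q ^+ i.*2.+1) * (1 - b * Q ^+ i.*2.+2)))
               * xi (a * Q ^+ r.*2) (b * Q ^+ r.*2) Q n.
Proof.
move=> Qn; elim: r => [|r IH]; first by rewrite big_ord0 double0 expr0 !mulr1 mul1r.
rewrite IH big_ord_recr /= -!mulrA; congr (_ * _).
have -> : Q ^+ r.+1.*2 = Q ^+ r.*2 * Q * Q by rewrite doubleS !exprSr.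
rewrite xi_swap // xi_swap // !(mulrA a) !(mulrA b) ![Q ^+ _.+1]exprSr.
ring.
Qed.

Lemma xi_00 Q n : xi 0 0 Q n = 1.
Proof.
have H : tau 0 0 Q n = 1 /\ xi 0 0 Q n = 1.
  elim: n => [|n [IH1 IH2]]; first by rewrite tau0 xi0 mul0r subr0.
  by rewrite xiS tauS IH2 !mul0r !subr0 addr0 mulr1.
by case: H.
Qed.

Lemma xi_limit a b Q n : Q ^+ n.*2 = 0 ->
  xi a b Q n.*2 = \prod_(i < n) ((1 - a * Q ^+ i.*2.+1) * (1 - b * Q ^+ i.*2.+2)).
Proof. by move=> Qn; rewrite (xi_product _ _ n Qn) Qn !mulr0 xi_00 mulr1. Qed.
End TauXi.

(** * Generating functions by largest part, with [q] nilpotent *)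

Definition allowed_mod6 (a : nat) : bool := (a %% 6)%N \in [:: 0; 1; 3; 5]%N.

Section NilpotentSeries.
Variables (R : comNzRingType) (q : R) (N : nat).
Hypothesis qN : q ^+ N = 0.

(* [L m] is the generating function of the partitions with largest part [m] whose
   adjacent parts satisfy [e], a virtual part 0 being appended: removing one
   copy of the largest part gives the recurrence. *)
Definition by_largest (e : rel nat) (L : nat -> R) :=
  L 0 = 1 /\
  forall m, L m.+1 = q ^+ m.+1 * \sum_(j < m.+2 | e m.+1 j) L j.

(** Its inverse is the generating function of partitions into parts at most [m] that satisfy [P]. *)
Definition euler (P : pred nat) m := \prod_(j < m | P j.+1) (1 - q ^+ j.+1).

Lemma eulerS P m :
  euler P m.+1 = euler P m * (if P m.+1 then 1 - q ^+ m.+1 else 1).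
Proof. by rewrite /euler !(big_mkcond (fun j => P _)) big_ord_recr. Qed.

Lemma eulerID (P P1 : pred nat) m :
  euler P m = euler (fun j => P j && P1 j) m * euler (fun j => P j && ~~ P1 j) m.
Proof. exact: bigID. Qed.

(** The geometric series of [q ^+ m.+1] stops because [q ^+ N = 0], and it inverts this factor. *)
Lemma lreg_1subX m : GRing.lreg (1 - q ^+ m.+1).
Proof.
apply: (@GRing.lregMl _ (\sum_(i < N) (q ^+ m.+1) ^+ i)).
have -> : (\sum_(i < N) (q ^+ m.+1) ^+ i) * (1 - q ^+ m.+1) = 1; last exact: lreg1.
apply: oppr_inj; rewrite -mulrN opprB mulrC -subrX1 exprAC qN expr0n.
by rewrite /= sub0r.
Qed.

Lemma lreg_euler P m : GRing.lreg (euler P m).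
Proof.
apply: (big_ind (@GRing.lreg R)) => [|x y|j _]; [exact: lreg1|exact: lregM|].
exact: lreg_1subX.
Qed.

Section Mod6.
Variable L : nat -> R.
Hypothesis HL : by_largest (fun a _ => allowed_mod6 a) L.

(** If [m.+1] is allowed, the new factor turns the longer sum back into the shorter one; otherwise
    [L m.+1 = 0]. *)
Lemma euler_sum_mod6 m : euler allowed_mod6 m * \sum_(j < m.+1) L j = 1.
Proof.
elim: m => [|m IH]; first by rewrite /euler big_ord0 big_ord1 HL.1 mul1r.
rewrite -[RHS]IH eulerS -mulrA; congr (_ * _).
have := HL.2 m; case: ifP => [_ /= Lm | _ /=].
  by rewrite mulrBl mul1r -Lm [X in X - _]big_ord_recr addrK.
by rewrite big_pred0_eq mulr0 => Lm; rewrite mul1r big_ord_recr /= Lm addr0.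
Qed.
End Mod6.

Section Adj.
Variable L : nat -> R.
Hypothesis HL : by_largest adj_ok L.
Let S m := \sum_(j < m.+1) L j.

Let SS m : S m.+1 = S m + L m.+1. Proof. by rewrite /S big_ord_recr. Qed.

(** Below a part 3n+1 the pair conditions exclude nothing. The term for a repeated 3n+1 moves to the
    left side. *)
Lemma largest_mod1 n :
  (1 - q ^+ (3 * n).+1) * L (3 * n).+1 = q ^+ (3 * n).+1 * S (3 * n).
Proof.
have E : L (3 * n).+1 = q ^+ (3 * n).+1 * S (3 * n).+1.
  rewrite {1}HL.2 /S; congr (_ * _); apply: eq_bigl => j; case: j => j /= Hj.
  rewrite /adj_ok; lia.
rewrite mulrBl mul1r {1}E SS; ring.
Qed.

(** Below a part 3n+2 exactly 3n+1 and 3n are excluded; for n = 0 this includes the virtual 0. *)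
Lemma largest_mod2 n :
  (1 - q ^+ (3 * n).+2) * L (3 * n).+2 = q ^+ (3 * n).+2 * (S (3 * n) - L (3 * n)).
Proof.
have E : L (3 * n).+2 = q ^+ (3 * n).+2 * (S (3 * n) - L (3 * n) + L (3 * n).+2).
  rewrite {1}HL.2 big_mkcond !big_ord_recr /=; congr (_ * _).
  rewrite /S big_ord_recr /= addrK.
  have -> : adj_ok (3 * n).+2 (3 * n).+1 = false.
    rewrite /adj_ok; lia.
  have -> : adj_ok (3 * n).+2 (3 * n) = false.
    rewrite /adj_ok; lia.
  have -> : adj_ok (3 * n).+2 (3 * n).+2.
    rewrite /adj_ok; lia.
  rewrite !addr0; congr (_ + _); apply: eq_bigr => -[j /= Hj] _.
  by rewrite ifT // /adj_ok; lia.
rewrite mulrBl mul1r {1}E; ring.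
Qed.

(** Below a part 3n+3 only 3n+1 is excluded. *)
Lemma largest_mod0 n :
  (1 - q ^+ (3 * n).+3) * L (3 * n).+3 =
  q ^+ (3 * n).+3 * (S (3 * n).+2 - L (3 * n).+1).
Proof.
have E : L (3 * n).+3 =
    q ^+ (3 * n).+3 * (S (3 * n).+2 - L (3 * n).+1 + L (3 * n).+3).
  rewrite {1}HL.2 big_mkcond !big_ord_recr /=; congr (_ * _).
  rewrite /S !big_ord_recr /=.
  have -> : adj_ok (3 * n).+3 (3 * n).+1 = false.
    rewrite /adj_ok; lia.
  have -> : adj_ok (3 * n).+3 (3 * n).
    rewrite /adj_ok; lia.
  have -> : adj_ok (3 * n).+3 (3 * n).+2.
    rewrite /adj_ok; lia.
  have -> : adj_ok (3 * n).+3 (3 * n).+3.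
    rewrite /adj_ok; lia.
  set A := \sum_(_ < _) _; set B := \sum_(_ < _) _.
  have -> : A = B by apply: eq_bigr => -[j /= Hj] _; rewrite ifT // /adj_ok; lia.
  ring.
rewrite mulrBl mul1r {1}E; ring.
Qed.

(** The factor [1 - q ^+ (3 * n).+1] lets [largest_mod1] eliminate the excluded term, leaving only
    partial sums. *)
Lemma sum_mod0 n :
  (1 - q ^+ (3 * n).+1) * (1 - q ^+ (3 * n).+3) * S (3 * n).+3 =
  (1 - q ^+ (3 * n).+1) * S (3 * n).+2 - q ^+ (3 * n).+1 * q ^+ (3 * n).+3 * S (3 * n).
Proof.
rewrite SS mulrDr -[X in _ + X = _]mulrA largest_mod0.
have H := largest_mod1 n.
have -> : (1 - q ^+ (3 * n).+1) * (q ^+ (3 * n).+3 * (S (3 * n).+2 - L (3 * n).+1)) =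
  (1 - q ^+ (3 * n).+1) * q ^+ (3 * n).+3 * S (3 * n).+2 -
  q ^+ (3 * n).+3 * ((1 - q ^+ (3 * n).+1) * L (3 * n).+1) by ring.
rewrite H; ring.
Qed.

Lemma sum_mod2 n :
  (1 - q ^+ (3 * n.+1).+1) * (1 - q ^+ (3 * n.+1).+2) * S (3 * n.+1).+2 =
  (1 - q ^+ (3 * n.+1).+2) * S (3 * n).+3
  + (1 - q ^+ (3 * n.+1).+1) * q ^+ (3 * n.+1).+2 * S (3 * n).+2.
Proof.
set a := q ^+ _; set b := q ^+ _.
have H1 := largest_mod1 n.+1; have H2 := largest_mod2 n.+1.
rewrite -/a -/b in H1 H2.
have E3 : (3 * n.+1 = (3 * n).+3)%N by lia.
have HS : S (3 * n.+1).+2 = S (3 * n.+1) + L (3 * n.+1).+1 + L (3 * n.+1).+2.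
  by rewrite (SS (3 * n.+1).+1) (SS (3 * n.+1)).
have HL3 : L (3 * n.+1) = S (3 * n).+3 - S (3 * n).+2.
  by rewrite E3 (SS (3 * n).+2) addrC addKr.
rewrite HS.
have -> : (1 - a) * (1 - b) * (S (3 * n.+1) + L (3 * n.+1).+1 + L (3 * n.+1).+2)
  = (1 - a) * (1 - b) * S (3 * n.+1) + (1 - b) * ((1 - a) * L (3 * n.+1).+1)
    + (1 - a) * ((1 - b) * L (3 * n.+1).+2) by ring.
rewrite H1 H2 HL3 E3; ring.
Qed.

Let P2 := euler (fun j => j != 2%N).

(** Once denominators are cleared, [sum_mod2] and [sum_mod0] are the recurrences [tauS] and [xiS] at
    a = q, b = q^2, Q = q^3. *)
Lemma tau_xi_sum n :
  P2 (3 * n).+2 * S (3 * n).+2 = tau q (q ^+ 2) (q ^+ 3) n /\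
  P2 (3 * n).+3 * S (3 * n).+3 = xi q (q ^+ 2) (q ^+ 3) n.
Proof.
have P2S m : P2 m.+3 = P2 m.+2 * (1 - q ^+ m.+3) by rewrite /P2 eulerS.
elim: n => [|n [IH1 IH2]].
  have P22 : P2 2 = 1 - q by rewrite /P2 !eulerS /euler big_ord0 mul1r mulr1.
  have S0 : S 0 = 1 by rewrite /S big_ord1 HL.1.
  have H1 := largest_mod1 0; have H2 := largest_mod2 0; have H := sum_mod0 0.
  rewrite !muln0 S0 HL.1 subrr mulr0 expr1 in H1 H2 H *.
  (* No admissible partition has largest part 2, hence no factor for j = 2 in [P2]. *)
  have L2 : L 2 = 0 by apply: (@lreg_1subX 1); rewrite H2 mulr0.
  have E : P2 2 * S 2 = 1.
    rewrite P22 !SS L2 S0 addr0 mulrDr [_ * L 1]H1; ring.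
  rewrite P2S P22 tau0 xi0; split; first by rewrite -P22.
  rewrite H -P22 E; ring.
have Ea : q ^+ (3 * n.+1).+1 = q * (q ^+ 3) ^+ n.+1.
  by rewrite -exprM -exprS.
have Eb : q ^+ (3 * n.+1).+2 = q ^+ 2 * (q ^+ 3) ^+ n.+1.
  by rewrite -exprM -exprD.
have Ec : q ^+ (3 * n).+3 = (q ^+ 3) ^+ n.+1.
  by rewrite -exprM; congr (_ ^+ _); lia.
have Ed : q ^+ (3 * n.+1).+3 = (q ^+ 3) ^+ n.+2.
  by rewrite -exprM; congr (_ ^+ _); lia.
have E3 : (3 * n.+1 = (3 * n).+3)%N by lia.
have P3 : P2 (3 * n.+1).+2 =
    P2 (3 * n).+3 * ((1 - q ^+ (3 * n.+1).+1) * (1 - q ^+ (3 * n.+1).+2)).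
  by rewrite E3 !P2S -!mulrA.
have IT : P2 (3 * n.+1).+2 * S (3 * n.+1).+2 = tau q (q ^+ 2) (q ^+ 3) n.+1.
  rewrite P3 -mulrA sum_mod2 tauS -IH1 -IH2 P2S Ea Eb Ec; ring.
split=> //; rewrite xiS -IT -IH2 P2S P3.
have -> : P2 (3 * n).+3 * ((1 - q ^+ (3 * n.+1).+1) * (1 - q ^+ (3 * n.+1).+2))
    * (1 - q ^+ (3 * n.+1).+3) * S (3 * n.+1).+3 =
  P2 (3 * n).+3 * (1 - q ^+ (3 * n.+1).+2) *
   ((1 - q ^+ (3 * n.+1).+1) * (1 - q ^+ (3 * n.+1).+3) * S (3 * n.+1).+3) by ring.
rewrite sum_mod0 Ea Eb Ed E3; ring.
Qed.

(** Among 6n+4, ..., 6n+9 only 6n+4 and 6n+8 contribute. Starting after 3 skips the exceptional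
    2. *)
Lemma euler_not_mod6 n :
  euler (fun j => (j != 2%N) && ~~ allowed_mod6 j) (6 * n).+3 =
  \prod_(i < n) ((1 - q * (q ^+ 3) ^+ i.*2.+1) * (1 - q ^+ 2 * (q ^+ 3) ^+ i.*2.+2)).
Proof.
elim: n => [|n IH]; first by rewrite !eulerS /euler !big_ord0 !mulr1.
rewrite big_ord_recr -IH /=.
have -> : ((6 * n.+1).+3 = (6 * n).+3.+4.+2)%N by lia.
pose c j := (j != 2%N) && ~~ allowed_mod6 j.
have c4 : c (6 * n).+4 by rewrite /c /allowed_mod6 !inE; lia.
have c5 : c (6 * n).+4.+1 = false by rewrite /c /allowed_mod6 !inE; lia.
have c6 : c (6 * n).+4.+2 = false by rewrite /c /allowed_mod6 !inE; lia.
have c7 : c (6 * n).+4.+3 = false by rewrite /c /allowed_mod6 !inE; lia.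
have c8 : c (6 * n).+4.+4 by rewrite /c /allowed_mod6 !inE; lia.
have c9 : c (6 * n).+4.+4.+1 = false by rewrite /c /allowed_mod6 !inE; lia.
rewrite -/c !eulerS c4 c5 c6 c7 c8 c9 !mulr1 -mulrA.
congr (_ * (_ * _)).
  by rewrite -exprM -exprS; congr (1 - q ^+ _); lia.
by rewrite -exprM -exprD; congr (1 - q ^+ _); lia.
Qed.
End Adj.

(** Both sums are inverse to [euler allowed_mod6]: for [L2], the factors with j = 2, 4 mod 6 and j
    <> 2 are exactly the limit of [xi] and cancel. *)
Lemma sum_by_largest_eq L1 L2 :
  by_largest (fun a _ => allowed_mod6 a) L1 ->
  by_largest adj_ok L2 ->
  \sum_(j < (6 * N).+4) L1 j = \sum_(j < (6 * N).+4) L2 j.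
Proof.
(* This bound is 3(2N)+3, the index of [xi] at 2N, where [xi_limit] applies. *)
move=> H1 H2; pose K := (6 * N).+3.
have E1 := euler_sum_mod6 H1 K.
have [_ E2] := tau_xi_sum H2 N.*2.
have KE : ((3 * N.*2).+3 = K)%N by rewrite /K; lia.
have Q0 : (q ^+ 3) ^+ N.*2 = 0.
  have -> : N.*2 = (N + N)%N by lia.
  by rewrite exprD -exprM mulnC exprM qN expr0n mul0r.
rewrite KE xi_limit // -euler_not_mod6 // -/K in E2.
set X1 := \sum_(j < _) L1 j in E1 *; set X2 := \sum_(j < _) L2 j in E2 *.
have EP : euler (fun j => j != 2%N) K = euler allowed_mod6 K *
    euler (fun j => (j != 2%N) && ~~ allowed_mod6 j) K.
  rewrite (eulerID _ allowed_mod6); congr (_ * _); apply: eq_bigl => j /=.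
  by rewrite andbC; case: eqP => [->|]; rewrite ?andbT.
have E3 : euler allowed_mod6 K * X2 = 1.
  apply: (@lreg_euler (fun j => (j != 2%N) && ~~ allowed_mod6 j) K).
  by rewrite mulr1 -[RHS]E2 EP; ring.
by rewrite -[RHS]mul1r -E1 mulrAC E3 mul1r.
Qed.
End NilpotentSeries.

Local Close Scope ring_scope.

(** * Enumeration of partitions by largest part *)

Lemma uniq_flatten_map (I T : eqType) (f : I -> seq T) (h : T -> I) l :
  (forall i, uniq (f i)) -> (forall i x, x \in f i -> h x = i) ->
  uniq l -> uniq (flatten [seq f i | i <- l]).
Proof.
move=> uf hf; elim: l => //= i l IH /andP[il ul].
rewrite cat_uniq uf IH // andbT -all_predC; apply/allP => x /=.
by move=> /flatten_mapP[j jl /hf xj]; apply: contra il => /hf <-; rewrite xj.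
Qed.

Lemma all_seqsS m k :
  all_seqs m k.+1 = [seq x :: s | x <- iota 0 m.+1, s <- all_seqs m k].
Proof. by []. Qed.

Lemma mem_all_seqs m k s : (s \in all_seqs m k) = (size s == k) && all (fun x => x <= m) s.
Proof.
elim: k s => [|k IH] s; first by rewrite inE; case: s.
rewrite all_seqsS.
apply/allpairsP/idP => [[[x t] [+ + ->]]|].
  by rewrite mem_iota IH /= eqSS ltnS => -> /andP[-> ->].
case: s => [|x t] //=; rewrite eqSS => /and3P[st xm tm].
have xI : x \in iota 0 m.+1 by rewrite mem_iota.
by exists (x, t); split; rewrite ?IH ?st.
Qed.

Lemma all_seqs_uniq m k : uniq (all_seqs m k).
Proof.
elim: k => // k IH; rewrite all_seqsS; apply: allpairs_uniq; rewrite ?iota_uniq //.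
by move=> [x s] [y t] _ _ /= [-> ->].
Qed.

Lemma mem_candidates n s :
  (s \in candidates n) = (size s <= n) && all (fun x => x <= n) s.
Proof.
apply/flatten_mapP/idP => [[k]|/andP[sn an]].
  by rewrite mem_iota mem_all_seqs ltnS => /= kn /andP[/eqP-> ->]; rewrite kn.
by exists (size s); rewrite ?mem_iota ?mem_all_seqs ?eqxx.
Qed.

Lemma candidates_uniq n : uniq (candidates n).
Proof.
apply: (@uniq_flatten_map _ _ _ size); rewrite ?iota_uniq // => k.
  exact: all_seqs_uniq.
by move=> s; rewrite mem_all_seqs => /andP[/eqP].
Qed.

(* For [adj_ok], the appended 0 excludes a smallest part 2, hence any part 2. *)
Definition chain (e : rel nat) (s : seq nat) :=
  sorted (fun a b => (b <= a) && e a b) (rcons s 0).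

Definition chain_partition (e : rel nat) (n : nat) (s : seq nat) :=
  [&& chain e s, all (fun x => 0 < x) s & sumn s == n].

Lemma chain_cons e a s :
  chain e (a :: s) = [&& head 0 s <= a, e a (head 0 s) & chain e s].
Proof. by rewrite /chain; case: s => [|b s] /=; rewrite -?andbA. Qed.

(* [k] is fuel, any [k > n] suffices; [m = 0] stands for the empty partition. *)
Fixpoint by_head (e : rel nat) k n m : seq (seq nat) :=
  if k is k'.+1 then
    if m == 0 then nseq (n == 0) [::]
    else if m <= n then
      [seq m :: s | j <- [seq j <- iota 0 m.+1 | e m j], s <- by_head e k' (n - m) j]
    else [::]
  else [::].

Lemma by_head0 e k n : by_head e k.+1 n 0 = nseq (n == 0) [::].
Proof. by []. Qed.

Lemma by_headS e k n m : by_head e k.+1 n m.+1 =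
  if m < n then
    [seq m.+1 :: s | j <- [seq j <- iota 0 m.+2 | e m.+1 j],
                     s <- by_head e k (n - m.+1) j]
  else [::].
Proof. by []. Qed.

Lemma mem_by_head e k n m s : n < k ->
  (s \in by_head e k n m) = chain_partition e n s && (head 0 s == m).
Proof.
rewrite /chain_partition; elim: k n m s => // k IH n [|m] s nk.
  rewrite by_head0 mem_nseq; case: s => [|[|a] s] /=; rewrite ?andbF //.
  by rewrite eqxx !andbT lt0b eq_sym.
rewrite by_headS; case: (ltnP m n) => mn; last first.
  rewrite in_nil; symmetry; apply/negbTE; case: s => [|a s] /=; first by rewrite andbF.
  by apply/negP => /andP[/and3P[_ _ /eqP E] /eqP am]; lia.
apply/allpairsPdep/idP => [[j [t [+ + ->]]]|].
  rewrite mem_filter mem_iota IH => [/andP[emj /= jm]|]; last by lia.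
  move=> /andP[/and3P[ct pt /eqP st] /eqP hj].
  by rewrite chain_cons hj emj ct pt st eqxx /=; lia.
case: s => [|a t]; first by rewrite andbF.
rewrite chain_cons => /andP[/and3P[/and3P[ha eah ct] /andP[_ pt] /eqP st] /eqP am].
rewrite /= in am st.
subst a; exists (head 0 t), t; split=> //.
  by rewrite mem_filter eah mem_iota.
rewrite IH; last by lia.
by rewrite ct eqxx andbT andTb; apply/andP; split=> //; apply/eqP; lia.
Qed.

Lemma by_head_uniq e k n m : n < k -> uniq (by_head e k n m).
Proof.
elim: k n m => // k IH n [|m] nk; first by rewrite by_head0; case: (n == 0).
rewrite by_headS; case: (ltnP m n) => // mn.
apply: allpairs_uniq_dep => [|j _|].
- by rewrite filter_uniq ?iota_uniq.
- by apply: IH; lia.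
move=> [i s] [j t] /allpairsPdep[i' [s' [_ Hs [? ?]]]] /allpairsPdep[j' [t' [_ Ht [? ?]]]].
(* The index [j] is the head of the tail, so equal lists come from equal pairs. *)
subst; move=> /= [est]; subst s'; move: Hs Ht.
rewrite !mem_by_head; [|lia|lia].
by move=> /andP[_ /eqP <-] /andP[_ /eqP <-].
Qed.

Definition count_by_head e n m := size (by_head e n.+1 n m).

(** The membership criterion does not mention the fuel, and the lists have no duplicates. *)
Lemma size_by_head e k n m : n < k -> size (by_head e k n m) = count_by_head e n m.
Proof.
move=> nk; apply: perm_size; apply: uniq_perm; rewrite ?by_head_uniq // => s.
by rewrite !mem_by_head.
Qed.

Lemma count_by_headS e n m : count_by_head e n m.+1 =
  if m < n then \sum_(j < m.+2 | e m.+1 j) count_by_head e (n - m.+1) j else 0.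
Proof.
rewrite {1}/count_by_head by_headS; case: ifP => // mn.
rewrite size_allpairs_dep sumnE big_map big_filter.
rewrite -[iota _ _]/(index_iota 0 m.+2) big_mkord.
by apply: eq_bigr => j _; rewrite size_by_head //; lia.
Qed.

Lemma count_by_head0 e n : count_by_head e n 0 = (n == 0).
Proof. by rewrite /count_by_head /= size_nseq. Qed.

Lemma count_by_head_gt e n m : n < m -> count_by_head e n m = 0.
Proof. by case: m => // m nm; rewrite count_by_headS ltnNge -ltnS nm. Qed.

Lemma num_partitionsE (P : seq nat -> bool) e n :
  (forall s, is_partition n s && P s = chain_partition e n s) ->
  num_partitions P n = \sum_(m < n.+1) count_by_head e n m.
Proof.
move=> PE; rewrite /num_partitions (eq_count PE) -size_filter.
transitivity (size (flatten [seq by_head e n.+1 n m | m <- iota 0 n.+1])); last first.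
  rewrite size_flatten /shape -map_comp sumnE big_map.
  by rewrite -[iota _ _]/(index_iota 0 n.+1) big_mkord.
apply/perm_size/uniq_perm.
- by rewrite filter_uniq ?candidates_uniq.
- apply: (@uniq_flatten_map _ _ _ (head 0)); rewrite ?iota_uniq // => m.
    exact: by_head_uniq.
  by move=> s; rewrite mem_by_head // => /andP[_ /eqP].
move=> s; rewrite mem_filter mem_candidates.
apply/idP/flatten_mapP => [/andP[cs _]|[m _]].
  exists (head 0 s); last by rewrite mem_by_head // cs eqxx.
  case/and3P: cs => _ _ /eqP <-; rewrite mem_iota /= ltnS.
  by case: s => //= a s; rewrite leq_addr.
rewrite mem_by_head // => /andP[cs _]; rewrite cs /=.
(* Positive parts bound both the length and every entry by the sum. *)
case/and3P: cs => _ ps /eqP <-; elim: s ps => //= a s IH /andP[a0 /IH/andP[ss aS]].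
rewrite leq_addr -add1n leq_add //=.
by apply: sub_all aS => x xs; rewrite (leq_trans xs) ?leq_addl.
Qed.

Lemma parts_mod6_chain n s :
  is_partition n s && parts_mod6 s = chain_partition (fun a _ => allowed_mod6 a) n s.
Proof.
rewrite /is_partition /chain_partition andbAC; congr (_ && _).
case: s => [|a s] //; rewrite /chain /=.
elim: s a => [|b s IH] a /=; first by rewrite /parts_mod6 /allowed_mod6 /= !andbT.
rewrite -!andbA -IH /parts_mod6 /allowed_mod6 /=.
by congr (_ && _); rewrite andbCA.
Qed.

Lemma cond2_chain n s : is_partition n s && cond2 s = chain_partition adj_ok n s.
Proof.
rewrite /is_partition /chain_partition -!andbA.
case pos: (all _ s); last by rewrite !andbF.
case: (sumn s == n); last by rewrite !andbF.
rewrite /= !andbT; case: s pos => [|a s] //; rewrite /chain /cond2 /=.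
elim: s a => [|b s IH] a /=.
  by rewrite andbT => a0; rewrite inE /adj_ok; lia.
move=> /and3P[a0 b0 ps]; rewrite -IH ?b0 //.
case ba: (b <= a) => //; case ab: (adj_ok a b); rewrite /= ?andbF //.
(* If [a] is 2, then [b] is 1 or 2, and [adj_ok] rules out 1; so 2 already occurs in the tail. *)
have -> : 2 \notin [:: a, b & s] = (2 \notin b :: s); last by [].
by move: ab ba; rewrite !in_cons /adj_ok; lia.
Qed.

Local Open Scope ring_scope.

(** * Counts as truncated power series *)

Section CountingSeries.
Variables (R : comNzRingType) (q : R) (N : nat).
Hypothesis qN : q ^+ N = 0.

Lemma shift_series (f : nat -> R) p :
  \sum_(n < N) (if (p <= n)%N then f (n - p)%N else 0) * q ^+ n =
  q ^+ p * \sum_(n < N) f n * q ^+ n.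
Proof.
pose g n := (if (p <= n)%N then f (n - p)%N else 0) * q ^+ n.
(* The added terms vanish by [q ^+ N = 0], and the first [p] terms by the cutoff in [g]. *)
transitivity (\sum_(n < N + p) g n).
  rewrite big_split_ord /= [X in _ = _ + X]big1 ?addr0 // => i _.
  by rewrite /g exprD qN mul0r mulr0.
rewrite addnC big_split_ord /= big1 ?add0r => [|i _]; last first.
  by rewrite /g leqNgt ltn_ord mul0r.
rewrite mulr_sumr; apply: eq_bigr => i _.
by rewrite /g leq_addr addKn exprD mulrCA.
Qed.

Definition head_series e m := \sum_(n < N) (count_by_head e n m)%:R * q ^+ n.

Lemma head_series_by_largest e : (0 < N)%N -> by_largest q e (head_series e).
Proof.
move=> N0; split=> [|m].
  rewrite /head_series -(prednK N0) big_ord_recl big1 ?addr0 => [|i _].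
    by rewrite count_by_head0 mulr1.
  by rewrite count_by_head0 mul0r.
rewrite /head_series exchange_big /=.
under [in RHS]eq_bigr => n _ do rewrite -mulr_suml.
rewrite -(shift_series (fun n => \sum_(j < m.+2 | e m.+1 j) (count_by_head e n j)%:R)).
apply: eq_bigr => n _; congr (_ * _); rewrite count_by_headS.
by case: ifP => // _; rewrite natr_sum.
Qed.

Lemma sum_head_series (P : seq nat -> bool) e K :
  (forall n s, is_partition n s && P s = chain_partition e n s) -> (N <= K)%N ->
  \sum_(m < K) head_series e m = \sum_(n < N) (num_partitions P n)%:R * q ^+ n.
Proof.
move=> PE NK; rewrite exchange_big /=; apply: eq_bigr => n _.
rewrite -mulr_suml (num_partitionsE (PE n)) natr_sum; congr (_ * _).
have nK : (n.+1 <= K)%N by apply: leq_trans NK.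
(* A largest part above [n] contributes nothing to the coefficient of index [n]. *)
rewrite -(subnKC nK) big_split_ord /= [X in _ + X]big1 ?addr0 // => j _.
by rewrite count_by_head_gt // addSn ltnS leq_addr.
Qed.
End CountingSeries.

(** * Comparison of coefficients *)

Lemma C1_C2_series (R : comNzRingType) (q : R) N : (0 < N)%N -> q ^+ N = 0 ->
  \sum_(n < N) (C1 n)%:R * q ^+ n = \sum_(n < N) (C2 n)%:R * q ^+ n.
Proof.
move=> N0 qN; have NK : (N <= (6 * N).+4)%N by lia.
rewrite -(sum_head_series q parts_mod6_chain NK) -(sum_head_series q cond2_chain NK).
by apply: (sum_by_largest_eq qN); apply: head_series_by_largest.
Qed.

(* Instantiated at the class of 'X in Z[X]/(X^N). *)
Lemma truncated_series_inj (c d : nat -> nat) N :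
  (forall (R : comNzRingType) (q : R), q ^+ N = 0 ->
    \sum_(n < N) (c n)%:R * q ^+ n = \sum_(n < N) (d n)%:R * q ^+ n) ->
  forall n, (n < N)%N -> c n = d n.
Proof.
move=> H n nN; pose h : {poly int} := 'X^N.
have N0 : (0 < N)%N by apply: leq_ltn_trans nN.
(* Positivity of [N] matters: [mk_monic] replaces a constant polynomial by ['X]. *)
have hE : mk_monic h = 'X^N by rewrite /h mk_monic_Xn prednK.
have series (u : nat -> nat) : \sum_(i < N) (u i)%:R * (in_qpoly h 'X) ^+ i =
    in_qpoly h (\poly_(i < N) (u i)%:R).
  rewrite poly_def rmorph_sum; apply: eq_bigr => i _.
  by rewrite -mul_polyC rmorphM rmorphXn /= polyC_natr rmorph_nat.
have XN : in_qpoly h 'X ^+ N = 0.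
  rewrite -rmorphXn; apply: val_inj => /=.
  by rewrite hE Pdiv.RingMonic.rmodpp // monicXn.
have small (u : nat -> nat) : in_qpoly h (\poly_(i < N) (u i)%:R) =
    \poly_(i < N) (u i)%:R :> {poly int}.
  by rewrite in_qpoly_small // hE size_polyXn ltnS size_poly.
have := H _ _ XN; rewrite !series => E.
have := congr1 (fun p : {poly %/ h} => (p : {poly int})`_n) E.
by rewrite small small !coef_poly nN => /eqP; rewrite Num.Theory.eqr_nat => /eqP.
Qed.

Theorem theorem1p3 (n : nat) : C1 n = C2 n.
Proof.
(* Order [n.+1] is the least truncation that keeps the coefficient of index [n]. *)
apply: (@truncated_series_inj _ _ n.+1) => // R q; exact: C1_C2_series.
Qed.
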